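(* Let $\mathcal B'\subset\mathcal B$ be finite sets and let $\vec{\mathcal H}'$ be a finite sequence of conjugacy classes of finitely generated subgroups of $F(\mathcal B')$. Then $\vec{\mathcal H}'$ is a Gersten representative with respect to $\mathcal B'$ (i.e. of minimal complexity in its $\mathrm{Aut}(F(\mathcal B'))$-orbit, computed with $\mathcal B'$-graphs) if and only if $\vec{\mathcal H}'$, regarded as a sequence of conjugacy classes of subgroups of $F(\mathcal B)\supset F(\mathcal B')$, is a Gersten representative with respect to $\mathcal B$.
   Context: $F(\mathcal B)$ is the free group on $\mathcal B$, identified with $\pi_1$ of the rose $R_{\mathcal B}$. For a conjugacy class $[[H]]$ of a finitely generated subgroup, $\Sigma([[H]])$ is the core of the covering graph of $R_{\mathcal B}$ corresponding to $H$, a finite graph with oriented edges labeled in $\mathcal B^{\pm1}$ (empty if $H=1$). The complexity $c(\vec{\mathcal H})$ of a sequence is the total number of edges of the graphs $\Sigma(\mathcal H_i)$; automorphisms act componentwise. A sequence is a Gersten representative (with respect to $\mathcal B$) if its complexity is minimal among all $\alpha\vec{\mathcal H}$, $\alpha\in\mathrm{Aut}(F(\mathcal B))$. *)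

(* Defs.v *)
(* Free groups as reduced words; Stallings core graphs
   described through their (positively oriented) edges. *)
From mathcomp Require Import all_boot.
Set Implicit Arguments. Unset Strict Implicit. Unset Printing Implicit Defensive.

Section FreeGroup.
Variable T : finType.

(* a letter (a, true) is a, (a, false) is a^-1 *)
Definition letter := (T * bool)%type.
Definition word := seq letter.

Definition inv_letter (x : letter) : letter := (x.1, ~~ x.2).

Fixpoint reduced (w : word) : bool :=
  match w with
  | x :: ((y :: _) as w') => (y != inv_letter x) && reduced w'
  | _ => true
  end.

Definition push (x : letter) (s : word) : word :=
  match s with
  | y :: s' => if y == inv_letter x then s' else x :: s
  | [::] => [:: x]
  end.

Fixpoint reduce (w : word) : word :=
  match w with
  | [::] => [::]
  | x :: w' => push x (reduce w')
  end.

(* group operations in the free group F(T), elements = reduced words *)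
Definition mulw (u v : word) : word := reduce (u ++ v).
Definition invw (u : word) : word := rev (map inv_letter u).

Definition cyc_reduced (w : word) : bool :=
  reduced w && (if w is x :: w' then last x w' != inv_letter x else true).

Definition in_F (S : {set T}) (w : word) : bool := all (fun x => x.1 \in S) w.

Definition in_sub (gens : seq word) (x : word) : Prop :=
  exists s : seq word,
    all (fun g => (g \in gens) || (invw g \in gens)) s /\ x = reduce (flatten s).

(* (w, b) names the edge Hw --b--> Hwb of the covering graph of R_S
   corresponding to H = <gens> (w in F(S)); it lies in the core iff it is
   traversed (positively, as first edge) by a closed cyclically reduced path
   starting at Hw, labelled r (nonempty, cyclically reduced, w r w^-1 in H). *)
Definition core_edge (S : {set T}) (gens : seq word) (w : word) (b : T) : Prop :=
  [/\ b \in S, reduced w, in_F S w &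
      exists r : word, [/\ cyc_reduced r, in_F S r, head (b, false) r = (b, true)
                          & in_sub gens (mulw (mulw w r) (invw w))]].

(* two edge names denote the same edge: same label and same coset Hw = Hw' *)
Definition edge_equiv (gens : seq word) (e e' : word * T) : Prop :=
  e.2 = e'.2 /\ in_sub gens (mulw e'.1 (invw e.1)).

Definition core_size (S : {set T}) (gens : seq word) (n : nat) : Prop :=
  exists es : seq (word * T),
    [/\ size es = n,
        (forall e, e \in es -> core_edge S gens e.1 e.2),
        uniq es,
        (forall e e', e \in es -> e' \in es -> edge_equiv gens e e' -> e = e')
     &  (forall w b, core_edge S gens w b -> exists2 e, e \in es & edge_equiv gens e (w, b))].

Definition seq_size (S : {set T}) (Hs : seq (seq word)) (n : nat) : Prop :=
  exists ns : seq nat,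
    [/\ size ns = size Hs,
        (forall i, i < size Hs -> core_size S (nth [::] Hs i) (nth 0 ns i))
      & n = sumn ns].

Definition is_aut (S : {set T}) (f : word -> word) : Prop :=
  [/\ (forall u, reduced u -> in_F S u -> reduced (f u) && in_F S (f u)),
      (forall u v, reduced u -> in_F S u -> reduced v -> in_F S v ->
          f (mulw u v) = mulw (f u) (f v)),
      (forall u v, reduced u -> in_F S u -> reduced v -> in_F S v ->
          f u = f v -> u = v)
    & (forall v, reduced v -> in_F S v ->
          exists2 u, reduced u && in_F S u & f u = v)].

Definition aut_img (f : word -> word) (Hs : seq (seq word)) : seq (seq word) :=
  map (map (fun g => f (reduce g))) Hs.

Definition gersten (S : {set T}) (Hs : seq (seq word)) : Prop :=
  exists n, seq_size S Hs n /\
    forall f, is_aut S f -> forall m, seq_size S (aut_img f Hs) m -> n <= m.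

End FreeGroup.

(* Main.v *)
(** The core graph of a subgroup of [F(B')] has the same edges over [B'] and over [T], and an
    automorphism of [F(B')] extends to [F(T)] by the identity. Conversely, let [alpha] be an
    automorphism of [F(T)]. For a suitable automorphism [beta] of [F(B')], the composite
    [psi = alpha \o beta] is Nielsen reduced: each image [psi y] of a letter factors as
    [t y * c y * (t y^-1)^-1] with a letter [c y], in such a way that, in the Cayley tree of
    [F(T)], the half-tree beyond the edge labelled [c y] that starts at [t y] contains [psi w]
    if and only if the reduced word [w] starts with [y]. Sending the edge labelled [y] that
    starts at [a] to the edge labelled [c y] that starts at [psi a * t y] is therefore
    injective, and it maps the core graph of [beta^-1 H] into the core graph of [alpha H]. *)
From HB Require Import structures.
From Stdlib Require Import Classical.
From mathcomp Require Import all_boot zify.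
Require Import Defs.

Set Implicit Arguments.
Unset Strict Implicit.
Unset Printing Implicit Defensive.

Local Open Scope group_scope.

(** * Words *)

Section Words.
Variable T : finType.
Implicit Types (x y : letter T) (u v w p q r : word T) (S : {set T}).

Definition noncancel : rel (letter T) := fun x y => y != inv_letter x.

Lemma inv_letterK : involutive (@inv_letter T).
Proof. by case=> a b; rewrite /inv_letter /= negbK. Qed.

Lemma inv_letter_neq x : inv_letter x != x.
Proof. by case: x => a []; rewrite /inv_letter xpair_eqE eqxx. Qed.

Lemma eq_inv_letter x y : (inv_letter x == y) = (x == inv_letter y).
Proof. by rewrite -(inj_eq (inv_inj inv_letterK)) inv_letterK. Qed.

Lemma eq_letter_index x y : x.1 = y.1 -> x != inv_letter y -> x = y.
Proof.
case: x y => [a b] [a' b'] /= <-; rewrite /inv_letter xpair_eqE eqxx /=.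
by case: b b' => [] [].
Qed.

Lemma noncancelC x y : noncancel x y = noncancel (inv_letter y) (inv_letter x).
Proof. by rewrite /noncancel inv_letterK eq_sym. Qed.

Lemma reducedE w : reduced w = sorted noncancel w.
Proof. by elim: w => // x [|y w] //= ->. Qed.

Lemma reduced_cons x w : reduced (x :: w) = path noncancel x w.
Proof. exact: reducedE. Qed.

Lemma reduced_behead x w : reduced (x :: w) -> reduced w.
Proof. by rewrite !reducedE => /path_sorted. Qed.

Lemma ohead_reduced_cons x w : reduced (inv_letter x :: w) -> (ohead w == Some x) = false.
Proof.
case: w => //= y w /andP[+ _]; rewrite inv_letterK => y_x.
by apply/negbTE; apply: contra y_x => /eqP[->].
Qed.

Lemma reduced_cons2 x y w : reduced (x :: y :: w) = noncancel x y && reduced (y :: w).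
Proof. by []. Qed.

Lemma reduced_rcons x y w :
  reduced (rcons (x :: w) y) = reduced (x :: w) && noncancel (last x w) y.
Proof. by rewrite rcons_cons !reduced_cons rcons_path. Qed.

Lemma reduced_cat_cons u x v :
  reduced (u ++ x :: v) = reduced (rcons u x) && reduced (x :: v).
Proof.
rewrite !reducedE; case: u => [|y u] //=.
by rewrite cat_path rcons_path /= andbA.
Qed.

Lemma reduced_catl u v : reduced (u ++ v) -> reduced u.
Proof. by rewrite !reducedE; case: u => // x u /=; rewrite cat_path => /andP[]. Qed.

Lemma reduced_catr u v : reduced (u ++ v) -> reduced v.
Proof. by rewrite !reducedE; elim: u => //= x u IH /path_sorted. Qed.

Lemma cyc_reducedE w : cyc_reduced w = cycle noncancel w.
Proof.
case: w => // x w; rewrite /cyc_reduced reduced_cons /= rcons_path; congr (_ && _).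
by rewrite /noncancel [x == _]eq_sym eq_inv_letter.
Qed.

Lemma cyc_reduced_cons x w : cyc_reduced (x :: w) = reduced (x :: rcons w x).
Proof. by rewrite cyc_reducedE reduced_cons. Qed.

Lemma cyc_reduced_rot n w : cyc_reduced (rot n w) = cyc_reduced w.
Proof. by rewrite !cyc_reducedE rot_cycle. Qed.

Lemma invw_cons x w : invw (x :: w) = rcons (invw w) (inv_letter x).
Proof. by rewrite /invw /= rev_cons. Qed.

Lemma invw_rcons w x : invw (rcons w x) = inv_letter x :: invw w.
Proof. by rewrite /invw map_rcons rev_rcons. Qed.

Lemma invw_cat u v : invw (u ++ v) = invw v ++ invw u.
Proof. by rewrite /invw map_cat rev_cat. Qed.

Lemma invwK : involutive (@invw T).
Proof. by move=> w; rewrite /invw map_rev revK mapK //; apply: inv_letterK. Qed.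

Lemma size_invw w : size (invw w) = size w.
Proof. by rewrite size_rev size_map. Qed.

Lemma reduced_invw w : reduced (invw w) = reduced w.
Proof.
rewrite !reducedE /invw rev_sorted sorted_map; apply: eq_sorted => x y /=.
by rewrite -noncancelC.
Qed.

Lemma reduced_push x w : reduced w -> reduced (push x w).
Proof.
case: w => [|y w] //= h; case: ifP => e; last by rewrite /= e.
by case: w h => //= z w /andP[].
Qed.

Lemma reduced_reduce w : reduced (reduce w).
Proof. by elim: w => //= x w; apply: reduced_push. Qed.

Lemma reduce_id w : reduced w -> reduce w = w.
Proof.
elim: w => // x w IH; rewrite reducedE => h /=.
rewrite IH ?reducedE ?(path_sorted h) //.
by case: w h {IH} => //= y w /andP[/negbTE ->].
Qed.

Lemma push_invK x w : reduced w -> push x (push (inv_letter x) w) = w.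
Proof.
case: w => [|y w] /=; first by rewrite eqxx.
rewrite inv_letterK; case: eqP => [->|_] h; last by rewrite /= eqxx.
by case: w h => //= z w /andP[/negbTE ->].
Qed.

Lemma reduce_catr u v : reduce (u ++ reduce v) = reduce (u ++ v).
Proof. by elim: u => [|x u /= ->] //; rewrite reduce_id ?reduced_reduce. Qed.

Lemma reduce_catl u v : reduce (reduce u ++ v) = reduce (u ++ v).
Proof.
elim: u => //= x u <-; case: (reduce u) => //= y w; case: eqP => // ->.
by rewrite push_invK ?reduced_reduce.
Qed.

Lemma reduce_invr w : reduce (w ++ invw w) = [::].
Proof.
elim: w => //= x w IH; rewrite invw_cons -cats1 catA -reduce_catl IH /=.
by rewrite eqxx.
Qed.

Lemma reduce_eq_or_shorter w : reduce w = w \/ size (reduce w) < size w.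
Proof.
elim: w => [|x w] /=; [by left | case=> [->|lt_w]].
  by case: w => [|y w] /=; [left | case: ifP => _; [right|left]].
right; case: (reduce w) lt_w => //= y v; case: ifP => //= _; lia.
Qed.

Lemma reduced_self_inverse w : reduced w -> w = invw w -> w = [::].
Proof.
have [n] := ubnP (size w); elim: n w => // n IH [|x w] // lt_n rw.
case/lastP: w lt_n rw => [|w y] lt_n rw.
  by move=> [e]; have := inv_letter_neq x; rewrite -e eqxx.
rewrite invw_cons invw_rcons => -[ex] /rcons_inj[ew ey].
have w_nil : w = [::].
  apply: IH ew; first by move: lt_n; rewrite /= size_rcons; lia.
  by move: rw; rewrite -cats1 -cat1s => /reduced_catr/reduced_catl.
by move: rw; rewrite w_nil /= ey eqxx.
Qed.

Lemma in_F_cat S u v : in_F S (u ++ v) = in_F S u && in_F S v.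
Proof. exact: all_cat. Qed.

Lemma in_F_rcons S w x : in_F S (rcons w x) = (x.1 \in S) && in_F S w.
Proof. exact: all_rcons. Qed.

Lemma in_F_invw S w : in_F S (invw w) = in_F S w.
Proof. by rewrite /in_F all_rev all_map. Qed.

Lemma in_F_last S x w : in_F S (x :: w) -> (last x w).1 \in S.
Proof. by move/allP; apply; apply: mem_last. Qed.

Lemma in_F_rot S n w : in_F S (rot n w) = in_F S w.
Proof. by apply: eq_all_r => x; rewrite mem_rot. Qed.

Lemma in_F_sub S S' w : S \subset S' -> in_F S w -> in_F S' w.
Proof. by move=> /subsetP SS'; apply: sub_all => x /SS'. Qed.

Lemma in_F_reduce S w : in_F S w -> in_F S (reduce w).
Proof.
elim: w => //= x w IH /andP[hx /IH]; case: (reduce w) => [|y v] /=; first by rewrite hx.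
by case: eqP => [_ /andP[]|_ h] //=; rewrite hx.
Qed.

Lemma in_F_setT w : in_F [set: T] w.
Proof. by apply/allP => x _; rewrite inE. Qed.

End Words.

(** * The free group *)

Section FreeGroup.
Variable T : finType.
Implicit Types (x y : letter T) (u v w r : word T) (S : {set T}) (b : T).

Record free_group := FreeGroup { fgval :> seq (letter T); reduced_fgval : reduced fgval }.

HB.instance Definition _ := [isSub for fgval].
HB.instance Definition _ := [Choice of free_group by <:].

Implicit Types g h : free_group.

Definition fg w : free_group := FreeGroup (reduced_reduce w).

Lemma fg_val g : fg g = g.
Proof. exact/val_inj/reduce_id/reduced_fgval. Qed.

Lemma val_fg w : reduced w -> fg w = w :> word T.
Proof. exact: reduce_id. Qed.

Lemma fg_reduce w : fg (reduce w) = fg w.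
Proof. exact: (fg_val (fg w)). Qed.

Definition fg_mul g h := fg (g ++ h).
Definition fg_inv g := fg (invw g).

Lemma fg_mulE u v : fg_mul (fg u) (fg v) = fg (u ++ v).
Proof. by apply: val_inj; rewrite /= reduce_catl reduce_catr. Qed.

Lemma fg_mulA : associative fg_mul.
Proof. by move=> g h k; rewrite -[g]fg_val -[h]fg_val -[k]fg_val !fg_mulE catA. Qed.

Lemma fg_mul1g : left_id (fg [::]) fg_mul.
Proof. by move=> g; rewrite -[g]fg_val fg_mulE. Qed.

Lemma fg_mulg1 : right_id (fg [::]) fg_mul.
Proof. by move=> g; rewrite -[g]fg_val fg_mulE cats0. Qed.

Lemma fg_mulgV : right_inverse (fg [::]) fg_inv fg_mul.
Proof.
by move=> g; rewrite -{1}[g]fg_val fg_mulE; apply: val_inj; rewrite /= reduce_invr.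
Qed.

Lemma fg_mulVg : left_inverse (fg [::]) fg_inv fg_mul.
Proof.
move=> g; rewrite -{2}[g]fg_val fg_mulE -{2}[fgval g]invwK.
by apply: val_inj; rewrite /= reduce_invr.
Qed.

HB.instance Definition _ :=
  isGroup.Build free_group fg_mulA fg_mul1g fg_mulg1 fg_mulVg fg_mulgV.

Lemma fg_cat u v : fg (u ++ v) = fg u * fg v.
Proof. by rewrite -fg_mulE. Qed.

Lemma fg_cons x w : fg (x :: w) = fg [:: x] * fg w.
Proof. by rewrite -fg_cat. Qed.

Lemma fg_rcons w x : fg (rcons w x) = fg w * fg [:: x].
Proof. by rewrite -fg_cat cats1. Qed.

Lemma fg_invw w : fg (invw w) = (fg w)^-1.
Proof.
apply/esym/mulg1_eq; rewrite -fg_cat; apply: val_inj.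
by rewrite /= reduce_invr.
Qed.

Lemma fg_inv_letter x : fg [:: inv_letter x] = (fg [:: x])^-1.
Proof. by rewrite -fg_invw. Qed.

Lemma fg_neg_letter b : fg [:: (b, false)] = (fg [:: (b, true)])^-1.
Proof. exact: (fg_inv_letter (b, true)). Qed.

Lemma fg_inj u v : reduced u -> reduced v -> fg u = fg v -> u = v.
Proof. by move=> ru rv /(congr1 fgval); rewrite !val_fg. Qed.

Lemma val_fgV g : g^-1 = invw g :> word T.
Proof. by rewrite -{1}[g]fg_val -fg_invw val_fg // reduced_invw reduced_fgval. Qed.

Lemma ohead_mul_letter g x y :
  ohead (g * fg [:: x]) = Some y -> ohead g <> Some y -> g = 1 /\ y = x.
Proof.
have := reduced_fgval g; rewrite -{2 3 4}[g]fg_val; case: (fgval g) => [|z w] rw.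
  by rewrite mul1g => -[->].
rewrite val_fg //; have [ex|x_last] := eqVneq x (inv_letter (last z w)).
  have rb : reduced (belast z w) by move: rw; rewrite lastI -cats1 => /reduced_catl.
  rewrite {1}lastI fg_rcons ex fg_inv_letter mulgK val_fg //.
  by case: (w) => //= ? ? [->].
rewrite -fg_rcons val_fg; last by rewrite reduced_rcons rw.
by move=> /= [->].
Qed.

Lemma mulwE u v : mulw u v = fg u * fg v :> word T.
Proof. by rewrite -fg_cat. Qed.

Definition fgOver S : {pred free_group} := [pred g : free_group | in_F S g].

Lemma fgOver_fg S w : in_F S w -> fg w \in fgOver S.
Proof. exact: in_F_reduce. Qed.

Lemma fgOver_letter S x : x.1 \in S -> fg [:: x] \in fgOver S.
Proof. by move=> xS; rewrite fgOver_fg //= xS. Qed.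

Lemma fgOver1 S : 1 \in fgOver S.
Proof. exact: (@fgOver_fg S [::]). Qed.

Lemma fgOverM S : mulg_closed (fgOver S).
Proof.
by move=> g h gS hS; rewrite -[g]fg_val -[h]fg_val -fg_cat fgOver_fg // in_F_cat; apply/andP.
Qed.

Lemma fgOverV S : invg_closed (fgOver S).
Proof. by move=> g gS; rewrite -[g]fg_val -fg_invw fgOver_fg ?in_F_invw. Qed.

HB.instance Definition _ S := isMulClosed.Build free_group (fgOver S) (@fgOverM S).
HB.instance Definition _ S := isInvClosed.Build free_group (fgOver S) (@fgOverV S).
HB.instance Definition _ S := isMul1Closed.Build free_group (fgOver S) (fgOver1 S).

Lemma fg_conjV u r : fg r ^ (fg u)^-1 = fg (u ++ r ++ invw u).
Proof. by rewrite conjgE invgK !fg_cat fg_invw. Qed.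

Lemma conj_letter_cyc_reduced x r : cyc_reduced r -> r != [::] ->
  reduced (x :: rcons r (inv_letter x)) \/
  exists2 n, x.1 \in unzip1 r & fg r ^ (fg [:: x])^-1 = fg (rot n r).
Proof.
case: r => // y r cr _.
case: (eqVneq y (inv_letter x)) => [->|y_x].
  right; exists 1%N; first exact: mem_head.
  by rewrite rot1_cons fg_cons fg_rcons fg_inv_letter conjgE invgK !mulgA mulgV mul1g.
case: (eqVneq (last y r) x) => [<-|l_x].
  right; exists (size (belast y r)); first exact/map_f/mem_last.
  by rewrite lastI -cats1 rot_size_cat !fg_cat conjgE invgK mulgK.
left; move: cr => /andP[ry _]; rewrite reduced_cons rcons_path -reduced_cons.
by rewrite reduced_cons2 /noncancel y_x ry /= eq_sym (inj_eq (inv_inj (@inv_letterK T))).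
Qed.

Lemma conj_cyc_reduced_over S w r : r != [::] -> reduced w -> cyc_reduced r ->
  fg r ^ (fg w)^-1 \in fgOver S -> in_F S w && in_F S r.
Proof.
elim/last_ind: w r => [|w x IH] r r0 rw cr.
  by rewrite invg1 conjg1 inE val_fg //; case/andP: cr.
case: (conj_letter_cyc_reduced x cr r0) => [rxr|[n x_r]].
  rewrite fg_conjV invw_rcons inE val_fg; first by rewrite !in_F_cat => /and3P[-> ->].
  rewrite cat_rcons reduced_cat_cons rw -cat_cons reduced_cat_cons rcons_cons rxr.
  by rewrite -invw_rcons reduced_invw.
rewrite fg_rcons invgM conjgM => -> wrS.
have rw' : reduced w by move: rw; rewrite -cats1 => /reduced_catl.
have /andP[wS rS] : in_F S w && in_F S (rot n r).
  by apply: IH => //; rewrite ?cyc_reduced_rot // -size_eq0 size_rot size_eq0.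
rewrite in_F_rot in rS; rewrite in_F_rcons wS rS !andbT.
by move: rS; rewrite /in_F -(all_map fst (mem S)) => /allP; apply.
Qed.

End FreeGroup.

Section Junctions.
Variable T : finType.
Implicit Types (x y : letter T) (p q : word T).

Lemma reduced_invw_cat x p y q : reduced (x :: p) -> reduced (y :: q) -> x != y ->
  reduced (invw (x :: p) ++ y :: q).
Proof.
move=> rp rq xy; rewrite reduced_cat_cons rq invw_cons -cats1 cat_rcons reduced_cat_cons.
by rewrite -invw_cons reduced_invw rp /= andbT inv_letterK eq_sym xy.
Qed.

Lemma reduced_junction_neq_head p x q y :
  reduced (rcons p x) -> reduced (rcons q y) -> head x p != head y q ->
  reduced (inv_letter x :: rcons (reduce (invw p ++ q)) y).
Proof.
move=> rp rq pq; have : reduced (invw (rcons p x) ++ rcons q y).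
  by case: p q rp rq pq => [|a p] [|b q]; apply: reduced_invw_cat.
rewrite invw_rcons cat_cons -rcons_cat => r; rewrite reduce_id //.
by move: r; rewrite -cat1s -cats1 => /reduced_catr/reduced_catl.
Qed.

Lemma reduced_junction p x q y : reduced (rcons p x) -> reduced (rcons q y) ->
  ~~ prefix (rcons p x) (rcons q y) -> ~~ prefix (rcons q y) (rcons p x) ->
  reduced (inv_letter x :: rcons (reduce (invw p ++ q)) y).
Proof.
elim: p q => [|a p IH] [|b q] rp rq pq qp.
- by apply: reduced_junction_neq_head => //; move: pq; rewrite /= andbT.
- by apply: reduced_junction_neq_head => //; move: pq; rewrite /= prefix0s andbT.
- by apply: reduced_junction_neq_head => //; move: qp; rewrite /= prefix0s andbT eq_sym.
have [eab|ab] := eqVneq a b; last exact: reduced_junction_neq_head.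
move: pq qp; rewrite -eab !rcons_cons !prefix_cons !eqxx /= => pq qp.
have -> : reduce (invw (a :: p) ++ a :: q) = reduce (invw p ++ q).
  suff : fg (invw (a :: p) ++ a :: q) = fg (invw p ++ q) by move/(congr1 (@fgval T)).
  by rewrite !fg_cat !fg_invw (fg_cons a p) (fg_cons a q) invgM -mulgA mulKg.
by apply: IH => //; [move: rp | move: rq]; rewrite rcons_cons -cat1s => /reduced_catr.
Qed.

End Junctions.

(** * Homomorphisms and automorphisms *)

Local Notation hom G H := (UMagmaMorphism.type G H).

Section Lift.
Variables (T : finType) (G : groupType).
Implicit Types (x : letter T) (w : word T) (S : {set T}) (b : T) (k : T -> G).

Definition lift_letter k x : G := if x.2 then k x.1 else (k x.1)^-1.

Definition fg_lift k (g : free_group T) : G := \prod_(x <- fgval g) lift_letter k x.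

Lemma lift_letterV k x : lift_letter k (inv_letter x) = (lift_letter k x)^-1.
Proof. by rewrite /lift_letter; case: x => b [] //=; rewrite invgK. Qed.

Lemma fg_lift_fg k w : fg_lift k (fg w) = \prod_(x <- w) lift_letter k x.
Proof.
rewrite /fg_lift /=; elim: w => //= x w IH; rewrite big_cons -IH.
case: (reduce w) => [|y v] /=; first by rewrite big_cons.
by case: eqP => [->|_]; rewrite !big_cons // lift_letterV mulgA mulgV mul1g.
Qed.

Lemma fg_lift_is_monoid_morphism k : monoid_morphism (fg_lift k).
Proof.
split=> [|g h]; first by rewrite fg_lift_fg big_nil.
by rewrite -[g]fg_val -[h]fg_val -fg_cat !fg_lift_fg big_cat.
Qed.

HB.instance Definition _ k :=
  isUMagmaMorphism.Build (free_group T) G (fg_lift k) (fg_lift_is_monoid_morphism k).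

Lemma fg_lift_pos k b : fg_lift k (fg [:: (b, true)]) = k b.
Proof. by rewrite fg_lift_fg big_seq1. Qed.

Lemma hom_stable S (phi : hom (free_group T) G) (P : groupClosed G) :
  (forall b, b \in S -> phi (fg [:: (b, true)]) \in P) ->
  {in fgOver S, forall g, phi g \in P}.
Proof.
move=> SP g; rewrite -{2}[g]fg_val inE; elim: (fgval g) => [|[b s] w IH] /=.
  by move=> _; rewrite gmulf1 gpred1.
move=> /andP[bS /IH wP]; rewrite fg_cons gmulfM gpredM //; case: s; first exact: SP.
by rewrite fg_neg_letter gmulfV gpredV SP.
Qed.

Lemma eq_hom (phi psi : hom (free_group T) G) :
  (forall b, phi (fg [:: (b, true)]) = psi (fg [:: (b, true)])) -> phi =1 psi.
Proof.
move=> eqb g; rewrite -[g]fg_val; elim: (fgval g) => [|[b s] w IH]; first by rewrite !gmulf1.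
rewrite fg_cons !gmulfM IH; congr (_ * _); case: s; first exact: eqb.
by rewrite fg_neg_letter !gmulfV eqb.
Qed.

End Lift.

Section WordFun.
Variables (T U : finType) (phi : hom (free_group T) (free_group U)).

Definition word_fun (w : word T) : word U := phi (fg w).

Lemma word_fun_reduce w : word_fun (reduce w) = word_fun w.
Proof. by rewrite /word_fun fg_reduce. Qed.

Lemma fg_word_fun w : fg (word_fun w) = phi (fg w).
Proof. exact: fg_val. Qed.

End WordFun.

Section Automorphisms.
Variable T : finType.
Implicit Types (u v : word T) (S : {set T}) (b : T).
Implicit Types (g h : free_group T) (phi psi : hom (free_group T) (free_group T)).

(* An automorphism of [F(S)] is represented by an automorphism of [F(T)] that preserves [F(S)]. *)
Definition aut_on S phi : Prop :=
  exists psi, [/\ cancel phi psi, cancel psi phi,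
    {in fgOver S, forall g, phi g \in fgOver S} & {in fgOver S, forall g, psi g \in fgOver S}].

Lemma aut_on_id S : aut_on S idfun.
Proof. by exists idfun; split=> // g. Qed.

Lemma aut_on_comp S phi psi : aut_on S phi -> aut_on S psi -> aut_on S (phi \o psi).
Proof.
move=> [phi' [phiK phiK' phiS phiS']] [psi' [psiK psiK' psiS psiS']].
exists (psi' \o phi'); split=> [g|g|g gS|g gS] /=; rewrite ?phiK ?psiK ?psiK' ?phiK' //.
  exact/phiS/psiS.
exact/psiS'/phiS'.
Qed.

Lemma aut_on_inv S phi : aut_on S phi -> exists2 psi, aut_on S psi & cancel psi phi.
Proof. by case=> psi [phiK psiK phiS psiS]; exists psi => //; exists phi. Qed.

Lemma aut_on_setT S phi : aut_on S phi -> aut_on [set: T] phi.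
Proof. by case=> psi [phiK psiK _ _]; exists psi; split=> // g _; apply: in_F_setT. Qed.

Lemma is_aut_word_fun S phi : aut_on S phi -> is_aut S (word_fun phi).
Proof.
case=> psi [phiK psiK phiS psiS].
split=> [u ru uS|u v ru uS rv vS|u v ru uS rv vS|v rv vS].
- by rewrite reduced_fgval; apply/phiS/fgOver_fg.
- by rewrite !mulwE /word_fun !fg_val gmulfM.
- by move/val_inj/(can_inj phiK)/fg_inj->.
- exists (psi (fg v)); last by rewrite /word_fun fg_val psiK val_fg.
  by rewrite reduced_fgval; apply/psiS/fgOver_fg.
Qed.

Lemma hom_aut_on S phi :
  (forall b, b \notin S -> phi (fg [:: (b, true)]) = fg [:: (b, true)]) ->
  {in fgOver S, forall g, phi g \in fgOver S} -> {in fgOver S &, injective phi} ->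
  {in fgOver S, forall h, exists2 g, g \in fgOver S & phi g = h} -> aut_on S phi.
Proof.
move=> phi_out phiS phi_inj phi_surj.
have /fin_all_exists[k kP] : forall b, exists g,
    [/\ phi g = fg [:: (b, true)], b \in S -> g \in fgOver S
      & b \notin S -> g = fg [:: (b, true)]].
  move=> b; have [bS|bS] := boolP (b \in S); last by exists (fg [:: (b, true)]); rewrite phi_out.
  by have [g gS gb] := phi_surj _ (fgOver_letter (bS : (b, true).1 \in S)); exists g.
pose psi : hom _ _ := fg_lift k.
have psiS : {in fgOver S, forall g, psi g \in fgOver S}.
  by apply: hom_stable => b bS; rewrite /= fg_lift_pos; have [_ /(_ bS)] := kP b.
have psiK : cancel psi phi.
  apply: (eq_hom (phi := phi \o psi) (psi := idfun)) => b /=.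
  by rewrite fg_lift_pos; have [] := kP b.
exists psi; split=> //.
apply: (eq_hom (phi := psi \o phi) (psi := idfun)) => b /=.
have [bS|bS] := boolP (b \in S); last first.
  by rewrite phi_out // fg_lift_pos; have [_ _ /(_ bS)] := kP b.
by apply: phi_inj; rewrite ?psiK ?psiS ?phiS ?fgOver_letter.
Qed.

Lemma is_aut_extend S f : is_aut S f ->
  exists2 phi : hom (free_group T) (free_group T),
    forall b, b \notin S -> phi (fg [:: (b, true)]) = fg [:: (b, true)] &
    forall u, in_F S u -> f (reduce u) = word_fun phi u.
Proof.
move=> [f_over f_mul _ _].
have fM u v : in_F S u -> in_F S v ->
    fg (f (reduce (u ++ v))) = fg (f (reduce u)) * fg (f (reduce v)).
  move=> uS vS; have -> : reduce (u ++ v) = mulw (reduce u) (reduce v).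
    by rewrite /mulw reduce_catl reduce_catr.
  by rewrite f_mul ?reduced_reduce ?in_F_reduce // mulwE fg_val.
have f1 : fg (f [::]) = 1.
  by apply: (@mulgI _ (fg (f [::]))); rewrite mulg1; apply/esym/(fM [::] [::]).
have fV x : x.1 \in S -> fg (f [:: inv_letter x]) = (fg (f [:: x]))^-1.
  move=> xS; apply/esym/mulg1_eq/etrans; last exact: f1.
  by rewrite -(fM [:: x] [:: inv_letter x]) /= ?xS // eqxx.
pose phi : hom (free_group T) (free_group T) :=
  fg_lift (fun b => fg (if b \in S then f [:: (b, true)] else [:: (b, true)])).
exists phi => [b /negbTE bS|u uS]; first by rewrite /= fg_lift_pos bS.
have phi_letter x : x.1 \in S -> phi (fg [:: x]) = fg (f [:: x]).
  case: x => b [] /= bS; first by rewrite fg_lift_pos bS.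
  rewrite -[(b, false)]/(inv_letter (b, true)) fV // fg_inv_letter gmulfV /=.
  by rewrite fg_lift_pos bS.
have /andP[rfu _] := f_over _ (reduced_reduce u) (in_F_reduce uS).
rewrite -(val_fg rfu) /word_fun; congr fgval.
elim: u uS {rfu} => [|x u IH] uS; first by rewrite f1 gmulf1.
case/andP: (uS) => xS uS'.
rewrite -[in LHS]cat1s fM ?IH //; last by rewrite /= xS.
by rewrite fg_cons gmulfM phi_letter.
Qed.

Lemma is_aut_hom S f : is_aut S f ->
  exists2 phi, aut_on S phi & forall u, in_F S u -> f (reduce u) = word_fun phi u.
Proof.
move=> autf; have [phi phi_out fE] := is_aut_extend autf.
have [f_over _ f_inj f_surj] := autf.
have fgE g : g \in fgOver S -> f g = phi g.
  by move=> gS; rewrite -{1}(reduce_id (reduced_fgval g)) fE // /word_fun fg_val.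
exists phi => //; apply: hom_aut_on => // [g gS|g h gS hS eq_gh|h hS].
- by have /andP[_] := f_over _ (reduced_fgval g) gS; rewrite fgE.
- by apply/val_inj/f_inj; rewrite ?reduced_fgval //= !fgE // eq_gh.
- have [u /andP[ru uS] fu] := f_surj _ (reduced_fgval h) hS.
  by exists (fg u); [apply: fgOver_fg | apply: val_inj; rewrite /= -fgE ?fgOver_fg ?val_fg].
Qed.

End Automorphisms.

(** * Subgroups and core graphs *)

Section Generated.
Variable T : finType.
Implicit Types (u v w : word T) (S : {set T}) (H : seq (word T)) (g h : free_group T).

Definition gens_over S H : Prop := {in H, forall u, in_F S u}.

Definition generated H g : Prop := in_sub H g.

Lemma generatedP H g : generated H g <->
  exists2 s, all (fun u => (u \in H) || (invw u \in H)) s & g = \prod_(u <- s) fg u.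
Proof.
have fg_flatten s : fg (flatten s) = \prod_(u <- s) fg u :> free_group T.
  by elim: s => [|u s IH]; rewrite ?big_nil ?big_cons -?IH -?fg_cat.
split=> [[s [sH gs]]|[s sH ->]]; exists s => //; last by rewrite -fg_flatten.
by rewrite -fg_flatten; apply: val_inj.
Qed.

Lemma generatedM H g h : generated H g -> generated H h -> generated H (g * h).
Proof.
move=> /generatedP[s sH ->] /generatedP[s' s'H ->]; apply/generatedP.
by exists (s ++ s'); rewrite ?all_cat ?sH // big_cat.
Qed.

Lemma generatedV H g : generated H g -> generated H g^-1.
Proof.
move=> /generatedP[s sH ->]; apply/generatedP; exists (rev (map (@invw T) s)).
  by rewrite all_rev all_map; apply: sub_all sH => u /=; rewrite invwK orbC.
elim: s {sH} => [|u s IH]; first by rewrite !big_nil invg1.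
by rewrite big_cons invgM IH /= rev_cons big_rcons /= fg_invw.
Qed.

Lemma generated_over S H g : gens_over S H -> generated H g -> g \in fgOver S.
Proof.
move=> HS /generatedP[s sH ->]; elim: s sH => [|u s IH] /=.
  by rewrite big_nil gpred1.
move=> /andP[uH /IH sS]; rewrite big_cons; apply: gpredM => //.
by apply: fgOver_fg; case/orP: uH => /HS //; rewrite in_F_invw.
Qed.

End Generated.

Lemma generated_map (T U : finType) (phi : hom (free_group T) (free_group U)) H h :
  generated (map (word_fun phi) H) h <-> exists2 g, generated H g & h = phi g.
Proof.
split=> [/generatedP[s sH ->]|[g /generatedP[s sH ->] ->]]; last first.
  apply/generatedP; exists (map (word_fun phi) s).
    rewrite all_map; apply: sub_all sH => u /= /orP[/map_f-> //|/(map_f (word_fun phi))].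
    by rewrite /word_fun fg_invw gmulfV val_fgV => ->; rewrite orbT.
  by rewrite gmulf_prod big_map; apply: eq_bigr => u _; rewrite fg_val.
elim: s sH => [|u s IH] /=.
  exists 1; rewrite ?big_nil ?gmulf1 //.
  by apply/generatedP; exists [::]; rewrite ?big_nil.
case/andP=> uH /IH[g Hg eg]; suff [h' Hh' uh'] : exists2 h', generated H h' & fg u = phi h'.
  by exists (h' * g); [apply: generatedM | rewrite big_cons uh' eg gmulfM].
have in_gen v : v \in H -> generated H (fg v).
  by move=> vH; apply/generatedP; exists [:: v]; rewrite ?big_seq1 //= vH.
case/orP: uH => /mapP[v vH ev].
  by exists (fg v); [apply: in_gen | rewrite ev fg_val].
exists (fg v)^-1; first exact/generatedV/in_gen.
by rewrite gmulfV -fg_word_fun -fg_invw -ev invwK.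
Qed.

Section Transversals.
Variables (A B : eqType) (E : A -> A -> Prop).

Definition transversal (P : A -> Prop) (es : seq A) : Prop :=
  [/\ {in es, forall e, P e}, uniq es, {in es &, forall e e', E e e' -> e = e'}
    & forall a, P a -> exists2 e, e \in es & E e a].

Lemma eq_transversal (P P' : A -> Prop) es :
  (forall a, P a <-> P' a) -> transversal P es -> transversal P' es.
Proof. by move=> PP' [esP ues inj cov]; split=> // [e /esP/PP'|a /PP'/cov]. Qed.

Lemma transversal_of_cover (R : A -> B -> Prop) (es : seq B) (P : A -> Prop) :
  (forall a a', E a a' -> E a' a) ->
  (forall a a' e, P a -> P a' -> R a e -> R a' e -> E a a') ->
  (forall a, P a -> exists2 e, e \in es & R a e) ->
  exists2 es', size es' <= size es & transversal P es'.
Proof.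
move=> Esym; elim: es P => [|e es IH] P fib cov; first by exists [::]; split=> // a /cov[].
have cov_tail a : P a -> ~ R a e -> exists2 e', e' \in es & R a e'.
  by move=> /cov[e']; rewrite inE => /predU1P[-> //|]; exists e'.
have [[a0 [Pa0 Ra0]]|no] := classic (exists a, P a /\ R a e); last first.
  have [|es' le_es tr] := IH P fib; last by exists es' => //; apply: leqW.
  by move=> a Pa; apply: cov_tail => // Ra; apply: no; exists a.
have [||es' le_es [es'P ues inj cov']] := IH (fun a => P a /\ ~ E a0 a).
- by move=> a a' e' [Pa _] [Pa' _]; apply: fib.
- by move=> a [Pa nE]; apply: cov_tail => // /(fib _ _ _ Pa0 Pa Ra0).
exists (a0 :: es') => //; split.
- by move=> a /predU1P[->|/es'P[]].
- by rewrite /= ues andbT; apply/negP => /es'P[_]; apply; apply: (fib _ _ e).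
- move=> a a' /predU1P[->|a_es] /predU1P[->|a'_es] // Eaa'.
  + by case: (es'P _ a'_es).
  + by case: (es'P _ a_es) => _; case; apply: Esym.
  + exact: inj.
- move=> a Pa; have [Ea|nE] := classic (E a0 a); first by exists a0; rewrite ?mem_head.
  by have [e' e'_es Ee'] := cov' a (conj Pa nE); exists e'; rewrite // inE e'_es orbT.
Qed.

End Transversals.

Section Core.
Variable T : finType.
Implicit Types (x : letter T) (w r : word T) (S : {set T}) (b : T).
Implicit Types (H : seq (word T)) (e : word T * T) (g a : free_group T).

(* As [core_edge], but [x] may be an inverse letter: the edge is then traversed backwards. *)
Definition core_dart S H a x : Prop :=
  exists r, [/\ cyc_reduced (x :: r), in_F S (x :: r) & generated H (fg (x :: r) ^ a^-1)].

Lemma core_edgeE S H w b :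
  core_edge S H w b <-> [/\ reduced w, in_F S w & core_dart S H (fg w) (b, true)].
Proof.
have genE r : in_sub H (mulw (mulw w r) (invw w)) = generated H (fg r ^ (fg w)^-1).
  by rewrite !mulwE fg_val fg_invw conjgE invgK mulgA.
split=> [[bS rw wS [[|x r] [cr rS ex rH]]]|[rw wS [r [cr rS rH]]]] //.
  by split=> //; exists r; rewrite -ex -genE.
split=> //; first by case/andP: rS.
by exists ((b, true) :: r); rewrite genE.
Qed.

Lemma core_dart_rev S H a x :
  core_dart S H a x -> core_dart S H (a * fg [:: x]) (inv_letter x).
Proof.
case=> r [cr rS rH]; exists (invw r); split.
- by rewrite cyc_reduced_cons -invw_cons -invw_rcons rcons_cons reduced_invw -cyc_reduced_cons.
- by move: rS; rewrite -in_F_invw invw_cons in_F_rcons.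
have -> : fg (inv_letter x :: invw r) ^ (a * fg [:: x])^-1 = (fg (x :: r) ^ a^-1)^-1.
  rewrite fg_cons (fg_cons x r) fg_inv_letter fg_invw -conjVg !invgM conjgM.
  by congr (_ ^ _); rewrite conjgE invgK !mulgA mulgV mul1g.
exact: generatedV.
Qed.

(* The edge [(w, x.1)], traversed with the label [x], leaves the coset of [dart_origin (fg w) x]. *)
Definition dart_origin a x : free_group T := if x.2 then a else a * fg [:: (x.1, true)].

Lemma dart_originF a a' x : dart_origin a x / dart_origin a' x = a / a'.
Proof. by rewrite /dart_origin; case: x.2; rewrite ?mulgKA. Qed.

Lemma dart_origin_over S a x : x.1 \in S -> a \in fgOver S -> dart_origin a x \in fgOver S.
Proof. by move=> xS aS; rewrite /dart_origin; case: x.2; rewrite ?gpredM ?fgOver_letter. Qed.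

Lemma core_dart_origin S H a x :
  core_dart S H a (x.1, true) -> core_dart S H (dart_origin a x) x.
Proof. by case: x => b [] //; apply: core_dart_rev. Qed.

Lemma core_dart_letter S H a x : core_dart S H a x -> x.1 \in S.
Proof. by case=> r [_ /andP[]]. Qed.

Lemma edge_equivE H e e' :
  edge_equiv H e e' <-> e.2 = e'.2 /\ generated H (fg e'.1 / fg e.1).
Proof. by rewrite /edge_equiv mulwE fg_invw. Qed.

Lemma edge_equiv_sym H e e' : edge_equiv H e e' -> edge_equiv H e' e.
Proof.
case/edge_equivE=> eb eH; apply/edge_equivE; split; first by rewrite eb.
by rewrite -invgF; apply: generatedV.
Qed.

Lemma edge_equiv_trans H e e' e'' :
  edge_equiv H e e' -> edge_equiv H e' e'' -> edge_equiv H e e''.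
Proof.
case/edge_equivE=> eb eH /edge_equivE[eb' eH']; apply/edge_equivE; rewrite eb; split=> //.
by rewrite -(divgKA (fg e'.1)); apply: generatedM.
Qed.

Lemma core_sizeE S H n : core_size S H n <->
  exists2 es, size es = n &
    transversal (edge_equiv H) (fun e => core_edge S H e.1 e.2) es.
Proof.
split=> [[es [ses esP ues inj cov]]|[es ses [esP ues inj cov]]]; exists es => //.
  by split=> // -[w b]; apply: cov.
by split=> // w b; apply: (cov (w, b)).
Qed.

Lemma core_edge_sub S S' H w b : S \subset S' -> gens_over S H ->
  core_edge S H w b <-> core_edge S' H w b.
Proof.
move=> SS' HS; split=> /core_edgeE[rw wS [r [cr rS rH]]]; apply/core_edgeE.
  by split=> //; [apply: in_F_sub wS | exists r; split=> //; apply: in_F_sub rS].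
have /andP[wS' rS'] : in_F S w && in_F S ((b, true) :: r).
  by apply: conj_cyc_reduced_over => //; apply: generated_over rH.
by split=> //; exists r.
Qed.

Lemma core_size_sub S S' H n : S \subset S' -> gens_over S H ->
  core_size S H n <-> core_size S' H n.
Proof.
move=> SS' HS; have eqE e := core_edge_sub e.1 e.2 SS' HS; rewrite !core_sizeE.
by split=> -[es ses tr]; exists es => //; apply: eq_transversal tr => e; rewrite eqE.
Qed.

Lemma seq_size_nil S n : seq_size S [::] n <-> n = 0%N.
Proof. by split=> [[ns [/size0nil-> _ ->]]|->] //; exists [::]. Qed.

Lemma seq_size_cons S H Hs n : seq_size S (H :: Hs) n <->
  exists m m', [/\ core_size S H m, seq_size S Hs m' & n = (m + m')%N].
Proof.
split=> [[ns [size_ns nsP ->]]|[m [m' [Hm [ns [size_ns nsP ->]] ->]]]].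
  case: ns size_ns nsP => [|m ns] //= [size_ns] nsP.
  exists m, (sumn ns); split=> //; first exact: (nsP 0).
  by exists ns; split=> // i; apply: (nsP i.+1).
by exists (m :: ns); split; rewrite //= ?size_ns // => -[|i] //; apply: nsP.
Qed.

Lemma seq_size_sub S S' Hs n : S \subset S' ->
  {in Hs, forall H, gens_over S H} -> seq_size S Hs n <-> seq_size S' Hs n.
Proof.
move=> SS'; elim: Hs n => [|H Hs IH] n HsS; first by rewrite !seq_size_nil.
have HS := HsS H (mem_head _ _).
have {}IH m : seq_size S Hs m <-> seq_size S' Hs m.
  by apply: IH => H' H'Hs; apply: HsS; rewrite inE H'Hs orbT.
by rewrite !seq_size_cons; split=> -[m [m' [Hm Hsm' ->]]]; exists m, m';
  split=> //; apply/IH || apply/(core_size_sub m SS' HS).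
Qed.

Lemma aut_img_word_fun S f (phi : hom (free_group T) (free_group T)) Hs :
  (forall u, in_F S u -> f (reduce u) = word_fun phi u) ->
  {in Hs, forall H, gens_over S H} ->
  aut_img f Hs = [seq map (word_fun phi) H | H <- Hs].
Proof.
by move=> fE HsS; apply/eq_in_map => H HHs; apply/eq_in_map => u uH; apply/fE/(HsS H HHs).
Qed.

End Core.

Lemma seq_size_map_leq (T U : finType) (S : {set T}) (S' : {set U})
    (F : seq (word T) -> seq (word U)) (G : seq (word T) -> seq (word T)) Hs m :
  {in Hs, forall H n, core_size S' (F H) n -> exists2 n', n' <= n & core_size S (G H) n'} ->
  seq_size S' (map F Hs) m -> exists2 m', m' <= m & seq_size S (map G Hs) m'.
Proof.
elim: Hs m => [|H Hs IH] m FG /=.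
  by move=> /seq_size_nil->; exists 0%N => //; apply/seq_size_nil.
case/seq_size_cons=> n [k [Hn Hsk ->]].
have [n' le_n Hn'] := FG H (mem_head _ _) n Hn.
have [|k' le_k Hsk'] := IH k _ Hsk; first by move=> H' H'Hs; apply: FG; rewrite inE H'Hs orbT.
by exists (n' + k')%N; [apply: leq_add | apply/seq_size_cons; exists n', k'].
Qed.

(** * Shortlex codes *)

Section Code.
Variable T : finType.
Implicit Types (x : letter T) (u v w p q t : word T).

Definition code_base : nat := #|{: T * bool}|.+1.
Definition digit x : nat := (enum_rank (x : T * bool)).+1.

(* All digits are positive, so the numerical order of the codes is the shortlex order on words. *)
Definition code w : nat := foldl (fun n x => n * code_base + digit x)%N 0 w.

Lemma digit_lt x : digit x < code_base.
Proof. by rewrite ltnS ltn_ord. Qed.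

Lemma code_rcons w x : code (rcons w x) = (code w * code_base + digit x)%N.
Proof. by rewrite /code foldl_rcons. Qed.

Lemma code_cat u v : code (u ++ v) = (code u * code_base ^ size v + code v)%N.
Proof.
elim/last_ind: v => [|v x IH]; first by rewrite cats0 muln1 addn0.
by rewrite -rcons_cat !code_rcons IH size_rcons mulnDl expnSr mulnA addnA.
Qed.

Lemma code_lt_exp w : code w < code_base ^ size w.
Proof.
elim/last_ind: w => [|w x IH] //; rewrite code_rcons size_rcons expnSr.
have := digit_lt x; nia.
Qed.

Lemma code_lt_size u v : size u < size v -> code u < code v.
Proof.
case: v => // x v; rewrite ltnS -cat1s code_cat => le_uv.
apply: leq_trans (code_lt_exp u) (leq_trans _ (leq_addr _ _)).
by apply: leq_trans (leq_pmull _ _) => //; apply: leq_pexp2l.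
Qed.

Lemma code_size_leq u v : code u < code v -> size u <= size v.
Proof.
move=> /ltnW le_uv; rewrite leqNgt; apply/negP => /code_lt_size.
by rewrite ltnNge le_uv.
Qed.

Lemma code_inj : injective code.
Proof.
elim/last_ind=> [|u x IH] v; case/lastP: v => [|v y] //; rewrite ?code_rcons.
- by move/eqP; rewrite eq_sym addn_eq0 andbF.
- by move/eqP; rewrite addn_eq0 andbF.
move=> e; have ediv w z : ((code w * code_base + digit z) %/ code_base = code w)%N.
  by rewrite divnMDl // divn_small ?digit_lt ?addn0.
have uv : u = v by apply: IH; rewrite -(ediv u x) e ediv.
by move: e; rewrite uv => /addnI[/val_inj/enum_rank_inj ->].
Qed.

(* Minimizing lengths alone would not rule out that exactly half of a basis element cancels; the
   code of the inverse makes the weight invariant under inversion. *)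
Definition weight w : nat := code w + code (invw w).

Lemma weight_invw w : weight (invw w) = weight w.
Proof. by rewrite /weight invwK addnC. Qed.

Lemma weight_lt_size u v : size u < size v -> weight u < weight v.
Proof.
move=> lt_uv; rewrite /weight -addSn; apply: leq_add; first exact: code_lt_size.
by rewrite ltnW // code_lt_size ?size_invw.
Qed.

Lemma weight_reduce w : weight (reduce w) <= weight w.
Proof. by have [->|/weight_lt_size/ltnW] := reduce_eq_or_shorter w. Qed.

Lemma weight_cat_ltn p q w : code p < code q -> size q <= size w ->
  weight (p ++ w) < weight (q ++ w).
Proof.
move=> lt_pq le_qw; have := code_size_leq lt_pq; rewrite leq_eqVlt => /predU1P[es|lt_s].
  rewrite /weight !invw_cat !code_cat !size_invw es.
  have := code_lt_exp (invw p); rewrite size_invw es.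
  have := leq_pexp2l (ltn0Sn _ : 0 < code_base) le_qw.
  have := leq_mul lt_pq (leqnn (code_base ^ size w)).
  rewrite mulSn; lia.
by apply: weight_lt_size; rewrite !size_cat ltn_add2r.
Qed.

(* [x] is the letter of the loop [u] at which the shortlex-smaller of the two arcs to its origin
   changes sides. *)
Definition balanced_split u t x t' : Prop :=
  [/\ u = t ++ x :: invw t', code t < code (rcons t' (inv_letter x))
    & code t' < code (rcons t x)].

Lemma balanced_split_invw u t x t' :
  balanced_split u t x t' -> balanced_split (invw u) t' (inv_letter x) t.
Proof.
by case=> -> lt_t lt_t'; split; rewrite ?inv_letterK // invw_cat invw_cons invwK cat_rcons.
Qed.

Lemma balanced_split_exists u : reduced u -> u != [::] ->
  exists t x t', balanced_split u t x t'.
Proof.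
move=> ru u0.
suff split_right p q : u = p ++ invw q -> code p < code q -> exists t x t', balanced_split u t x t'.
  by apply: (split_right [::] (invw u)); rewrite ?invwK // code_lt_size // size_invw lt0n size_eq0.
elim/last_ind: q p => [|q x IH] p; first by rewrite ltn0.
rewrite invw_rcons => eu lt_p.
case: (ltngtP (code q) (code (rcons p (inv_letter x)))) => [lt_q|lt_q|/code_inj eq_q].
- by exists p, (inv_letter x), q; split; rewrite ?inv_letterK.
- by apply: IH lt_q; rewrite cat_rcons.
by move: u0; rewrite -(reduce_id ru) eu eq_q -cat_rcons reduce_invr.
Qed.

Lemma code_ltn_not_prefix p q : reduced (p ++ invw q) -> code p < code q ->
  ~~ prefix q (p ++ invw q).
Proof.
move=> r lt_pq; apply/negP => /prefixP[w eqw].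
have /prefixP[d eqd] : prefix p q.
  rewrite prefixE; move/(congr1 (take (size p))): eqw.
  by rewrite (take_size_cat _ (erefl (size p))) takel_cat ?code_size_leq // => <-.
move: eqw; rewrite eqd invw_cat -catA => /eqP; rewrite eqseq_cat // eqxx /=.
rewrite eqseq_cat ?size_invw // => /andP[/eqP dd _].
have rd : reduced d.
  by move: r; rewrite eqd invw_cat => /reduced_catr/reduced_catl; rewrite reduced_invw.
by move: lt_pq; rewrite eqd (reduced_self_inverse rd) ?cats0 ?ltnn.
Qed.

End Code.

(** * Isolating factorizations *)

(* In the Cayley tree of [F(U)], the path of [psi y] from [1] crosses the edge labelled [c y]
   that starts at [t y]; reading [psi y] backwards exchanges [y] and [inv_letter y]. The last
   condition makes [c y] survive in the image of every reduced word. *)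
Definition isolating (T U : finType) (S : {set T})
    (psi : hom (free_group T) (free_group U)) (t : letter T -> word U)
    (c : letter T -> letter U) : Prop :=
  [/\ forall y, c (inv_letter y) = inv_letter (c y),
      forall y, y.1 \in S -> word_fun psi [:: y] = t y ++ c y :: invw (t (inv_letter y))
    & forall y z, y.1 \in S -> z.1 \in S -> z != y ->
        ~~ prefix (rcons (t y) (c y)) (word_fun psi [:: z])].

Section Isolating.
Variables (T U : finType) (S : {set T}) (psi : hom (free_group T) (free_group U)).
Variables (t : letter T -> word U) (c : letter T -> letter U).
Hypothesis iso : isolating S psi t c.
Implicit Types (y z : letter T) (r w : word T) (q : word U) (a g : free_group T).

Let c_inv y : c (inv_letter y) = inv_letter (c y).
Proof. by case: iso. Qed.

Let word_fun_letter y : y.1 \in S ->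
  word_fun psi [:: y] = t y ++ c y :: invw (t (inv_letter y)).
Proof. by case: iso => _ + _; apply. Qed.

Lemma isolating_letter y : y.1 \in S ->
  psi (fg [:: y]) * fg (t (inv_letter y)) = fg (t y) * fg [:: c y].
Proof.
move=> yS; rewrite -fg_word_fun word_fun_letter //.
by rewrite -cat_rcons fg_cat fg_rcons fg_invw mulgVK.
Qed.

Lemma reduced_branch y : y.1 \in S -> reduced (rcons (t y) (c y)).
Proof.
move=> yS; have := reduced_fgval (psi (fg [:: y])).
by rewrite -/(word_fun psi [:: y]) word_fun_letter // reduced_cat_cons => /andP[].
Qed.

Lemma prefix_branch y z : y.1 \in S -> z.1 \in S -> z != y ->
  ~~ prefix (rcons (t y) (c y)) (rcons (t z) (c z)).
Proof.
move=> yS zS zy; case: iso => _ _ /(_ y z yS zS zy); apply: contra => yz.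
by rewrite word_fun_letter // -cat_rcons prefix_catl.
Qed.

Definition turn y z : word U := fg (invw (t y) ++ t z).

Lemma fg_turn y z : fg (turn y z) = (fg (t y))^-1 * fg (t z).
Proof. by rewrite fg_val fg_cat fg_invw. Qed.

Lemma reduced_turn y z : y.1 \in S -> z.1 \in S -> y != z ->
  reduced (inv_letter (c y) :: rcons (turn y z) (c z)).
Proof.
by move=> yS zS yz; apply: reduced_junction; rewrite ?reduced_branch ?prefix_branch // eq_sym.
Qed.

(* The part of the path of [y :: r] that starts with the edge [c y]; it ends with [q] after the
   edge of the last letter. *)
Fixpoint walk y r q : word U :=
  c y :: (if r is z :: r' then turn (inv_letter y) z ++ walk z r' q else q).

Lemma walk_cons y r q : walk y r q = c y :: behead (walk y r q).
Proof. by case: r. Qed.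

Lemma walk_rcons y r q (x : letter U) : walk y r (rcons q x) = rcons (walk y r q) x.
Proof. by elim: r y => //= z r IH y; rewrite IH rcons_cat. Qed.

Lemma reduced_walk y r q : in_F S (y :: r) -> reduced (y :: r) ->
  reduced (c (last y r) :: q) -> reduced (walk y r q).
Proof.
elim: r y => // z r IH y /andP[yS rS] /andP[zy rr] rq.
have := IH z rS rr rq; rewrite [walk y _ _]/= (walk_cons z) -cat_cons reduced_cat_cons => ->.
rewrite rcons_cons andbT -[c y]inv_letterK -c_inv.
by case/andP: rS => zS _; apply: reduced_turn => //; rewrite eq_sym.
Qed.

Lemma isolating_walk y r q : in_F S (y :: r) ->
  psi (fg (y :: r)) * fg (t (inv_letter (last y r))) * fg q = fg (t y) * fg (walk y r q).
Proof.
elim: r y => [|z r IH] y /andP[yS rS].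
  by rewrite isolating_letter // [walk _ _ _]/= (fg_cons (c y) q) mulgA.
rewrite fg_cons gmulfM -!mulgA (mulgA (psi (fg (z :: r)))) IH // [walk y _ _]/=.
by rewrite (fg_cons (c y) (_ ++ _)) fg_cat fg_turn !mulgA -isolating_letter // mulgK.
Qed.

Lemma isolating_cons y r : in_F S (y :: r) -> reduced (y :: r) ->
  exists2 q, reduced (c y :: q) & psi (fg (y :: r)) = fg (t y) * fg (c y :: q).
Proof.
move=> rS rr; set q := invw (t (inv_letter (last y r))).
have lastS := in_F_last rS.
exists (behead (walk y r q)); rewrite -walk_cons; last by rewrite -isolating_walk // fg_invw mulgK.
by apply: reduced_walk; rewrite // -reduced_invw invw_cons invwK -c_inv reduced_branch.
Qed.

(* The half-tree beyond the edge [c y] contains the images of the words starting with [y], and of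
   no other ones. *)
Lemma isolating_half_tree y g : y.1 \in S -> g \in fgOver S ->
  (ohead ((fg (t y))^-1 * psi g) == Some (c y)) = (ohead g == Some y).
Proof.
move=> yS; have rg := reduced_fgval g; rewrite -[g]fg_val inE val_fg //.
case: (fgval g) rg => [|z w] rw wS.
  have ry : reduced (inv_letter (c y) :: invw (t y)).
    by rewrite -invw_rcons reduced_invw reduced_branch.
  by rewrite gmulf1 mulg1 -fg_invw val_fg ?(reduced_behead ry) // ohead_reduced_cons.
have [q rq ->] := isolating_cons wS rw; have zS : z.1 \in S by case/andP: wS.
have [->|zy] := eqVneq y z; first by rewrite mulKg val_fg //= !eqxx.
have rt : reduced (inv_letter (c y) :: turn y z ++ c z :: q).
  by rewrite -cat_cons reduced_cat_cons rcons_cons reduced_turn.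
rewrite mulgA -fg_turn -fg_cat val_fg ?(reduced_behead rt) // ohead_reduced_cons //=.
by apply/esym/negbTE; apply: contra zy => /eqP[->].
Qed.

(* An edge determines the half-tree beyond it. *)
Lemma isolating_edge_inj y z a : y.1 \in S -> z.1 \in S -> a \in fgOver S ->
  c y = c z -> fg (t y) = psi a * fg (t z) -> y = z /\ a = 1.
Proof.
move=> yS zS aS cyz ty.
have beyond g : g \in fgOver S -> (ohead g == Some y) = (ohead (a^-1 * g) == Some z).
  move=> gS; rewrite -!isolating_half_tree ?gpredM ?gpredV // ty cyz invgM -mulgA.
  by rewrite gmulfM gmulfV.
have yz : ohead (a * fg [:: z]) = Some y.
  by apply/eqP; rewrite beyond ?mulKg ?val_fg ?gpredM ?fgOver_letter //= eqxx.
have [|-> ->] := ohead_mul_letter yz; last by [].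
by apply/eqP; rewrite beyond // mulVg.
Qed.

Lemma core_dart_image H H' a y : a \in fgOver S ->
  (forall h, generated H' h <-> exists2 g, generated H g & h = psi g) ->
  core_dart S H a y -> core_dart [set: U] H' (psi a * fg (t y)) (c y).
Proof.
move=> aS H'H [r [cr rS rH]]; set q := turn (inv_letter (last y r)) y.
have rr : reduced (y :: r) by case/andP: cr.
have yS : y.1 \in S by case/andP: rS.
have lastS := in_F_last rS.
have last_y : y != inv_letter (last y r).
  by move: cr; rewrite cyc_reduced_cons -rcons_cons reduced_rcons => /andP[].
exists (behead (walk y r q)); rewrite -walk_cons in_F_setT; split=> //.
  rewrite (walk_cons y) cyc_reduced_cons -rcons_cons -walk_cons -walk_rcons.
  apply: reduced_walk => //; rewrite -[c (last y r)]inv_letterK -c_inv.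
  by apply: reduced_turn => //; rewrite eq_sym.
apply/H'H; exists (fg (y :: r) ^ a^-1) => //.
have walkE : psi (fg (y :: r)) * fg (t y) = fg (t y) * fg (walk y r q).
  by rewrite -isolating_walk // fg_turn -!mulgA mulVKg.
have -> : fg (walk y r q) = psi (fg (y :: r)) ^ fg (t y) by rewrite conjgE walkE mulKg.
by rewrite invgM conjgM conjgK gmulfJ gmulfV.
Qed.

End Isolating.

Section CoreInjection.
Variables (T U : finType) (S : {set T}) (psi : hom (free_group T) (free_group U)).
Variables (t : letter T -> word U) (c : letter T -> letter U).
Hypothesis iso : isolating S psi t c.
Variables (H : seq (word T)) (H' : seq (word U)).
Hypothesis HS : gens_over S H.
Hypothesis H'H : forall h, generated H' h <-> exists2 g, generated H g & h = psi g.
Implicit Types (b : T) (e : word T * T).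

Definition pos_lift b : letter T := (b, (c (b, true)).2).

Lemma c_pos_lift b : c (pos_lift b) = ((c (pos_lift b)).1, true).
Proof.
have [c_inv _ _] := iso; rewrite /pos_lift.
case cb: (c (b, true)) => [d []] /=; first by rewrite cb.
by rewrite -[(b, false)]/(inv_letter (b, true)) c_inv cb.
Qed.

Definition edge_base e := dart_origin (fg e.1) (pos_lift e.2).

Definition edge_image e : word U * U :=
  (fgval (psi (edge_base e) * fg (t (pos_lift e.2))), (c (pos_lift e.2)).1).

Lemma fg_edge_image e :
  fg (edge_image e).1 = psi (edge_base e) * fg (t (pos_lift e.2)).
Proof. exact: fg_val. Qed.

Lemma edge_base_over w b : core_edge S H w b -> b \in S /\ edge_base (w, b) \in fgOver S.
Proof.
case/core_edgeE=> _ wS /core_dart_letter bS; split=> //.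
by rewrite dart_origin_over // fgOver_fg.
Qed.

Lemma core_edge_image e : core_edge S H e.1 e.2 ->
  core_edge [set: U] H' (edge_image e).1 (edge_image e).2.
Proof.
case: e => w b /[dup]/edge_base_over[_ baseS] /core_edgeE[_ _ dart]; apply/core_edgeE.
rewrite reduced_fgval in_F_setT fg_edge_image -c_pos_lift; split=> //.
exact/(core_dart_image iso baseS H'H)/core_dart_origin.
Qed.

Lemma edge_image_inj e e' : core_edge S H e.1 e.2 -> core_edge S H e'.1 e'.2 ->
  edge_equiv H' (edge_image e) (edge_image e') -> edge_equiv H e e'.
Proof.
case: e e' => [w b] [w' b'] /edge_base_over[bS baseS] /edge_base_over[b'S base'S].
case/edge_equivE=> cc /H'H[g gH]; rewrite !fg_edge_image => eg.
set a := edge_base (w, b) in baseS eg; set a' := edge_base (w', b') in base'S eg.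
have aS : a'^-1 * (g * a) \in fgOver S by rewrite !gpredM ?gpredV // (generated_over HS).
have [||ebb' ga] := isolating_edge_inj iso (y := pos_lift b') (z := pos_lift b) b'S bS aS.
- by rewrite c_pos_lift (c_pos_lift b); congr (_, true); apply: esym.
- by rewrite !gmulfM gmulfV -eg -!mulgA mulKg mulVg mulg1.
have [bb' _] := ebb'; apply/edge_equivE; split=> //=.
rewrite -(dart_originF _ _ (pos_lift b)) -{1}ebb' -[dart_origin (fg w') _]/a'.
by rewrite -[a']mulg1 -ga mulVKg mulgK.
Qed.

Lemma core_size_image_leq n :
  core_size [set: U] H' n -> exists2 m, m <= n & core_size S H m.
Proof.
case/core_sizeE=> es <- [_ _ _ cov].
have [|e e' d eS e'S ed e'd|e /core_edge_image/cov[d]|es' le_es tr] :=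
  @transversal_of_cover _ _ (edge_equiv H) (fun e d => edge_equiv H' d (edge_image e)) es
    (fun e => core_edge S H e.1 e.2).
- exact: edge_equiv_sym.
- by apply: edge_image_inj => //; apply: edge_equiv_trans e'd; apply: edge_equiv_sym.
- by exists d.
by exists (size es') => //; apply/core_sizeE; exists es'.
Qed.

End CoreInjection.

(** * Nielsen reduction *)

Lemma exists_minimizer (A : Type) (P : A -> Prop) (m : A -> nat) a0 :
  P a0 -> exists2 a, P a & forall a', P a' -> m a <= m a'.
Proof.
have [n] := ubnP (m a0); elim: n a0 => // n IH a lt_n Pa.
have [[a' [Pa' lt_a]]|no] := classic (exists a', P a' /\ m a' < m a).
  by apply: IH Pa'; apply: leq_trans lt_a lt_n.
exists a => // a' Pa'; rewrite leqNgt; apply/negP => lt_a.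
by apply: no; exists a'.
Qed.

Section Transvections.
Variables (T : finType) (S : {set T}).
Implicit Types (x y z : letter T) (b : T).

Definition transvection y z : free_group T -> free_group T :=
  fg_lift (fun b => if b != z.1 then fg [:: (b, true)]
                    else if z.2 then fg [:: y; z] else (fg [:: y; z])^-1).

HB.instance Definition _ y z := UMagmaMorphism.on (transvection y z).

Lemma transvection_letter y z x : x.1 != z.1 -> transvection y z (fg [:: x]) = fg [:: x].
Proof.
case: x => b s /= bz; rewrite /transvection fg_lift_fg big_seq1 /lift_letter /= bz.
by case: s => //; rewrite -fg_neg_letter.
Qed.

Lemma transvection_same y z : transvection y z (fg [:: z]) = fg [:: y] * fg [:: z].
Proof.
rewrite /transvection fg_lift_fg big_seq1 /lift_letter /= eqxx /= -fg_cons.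
by case: z.2; rewrite ?invgK.
Qed.

Lemma transvectionK y z : y.1 != z.1 ->
  cancel (transvection (inv_letter y) z) (transvection y z).
Proof.
move=> yz; apply: (eq_hom (phi := transvection y z \o transvection (inv_letter y) z)
  (psi := idfun)) => b /=.
have zK : transvection y z (transvection (inv_letter y) z (fg [:: z])) = fg [:: z].
  rewrite transvection_same gmulfM /= transvection_letter //.
  by rewrite transvection_same fg_inv_letter mulKg.
have [->|bz] := eqVneq b z.1; last by rewrite !transvection_letter.
case: z zK {yz} => d [] //= zK; apply: invg_inj.
by rewrite -!gmulfV -fg_neg_letter.
Qed.

Lemma aut_on_transvection y z :
  y.1 \in S -> z.1 \in S -> y.1 != z.1 -> aut_on S (transvection y z).
Proof.
move=> yS zS yz.
have stable x : x.1 \in S -> {in fgOver S, forall g, transvection x z g \in fgOver S}.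
  move=> xS; apply: hom_stable => b bS; rewrite /= /transvection fg_lift_pos.
  by case: (b != z.1); case: z.2; rewrite ?gpredV fgOver_fg //= ?bS ?xS ?zS.
exists (transvection (inv_letter y) z); split; try exact: stable; last exact: transvectionK.
by have := @transvectionK (inv_letter y) z yz; rewrite inv_letterK.
Qed.

End Transvections.

Section NielsenMinimal.
Variables (T U : finType) (S : {set T}).
Implicit Types (psi : hom (free_group T) (free_group U)) (x y z : letter T) (b : T).

Definition total_weight psi : nat := \sum_(b in S) weight (psi (fg [:: (b, true)])).

Lemma weight_pos_letter psi x :
  weight (psi (fg [:: (x.1, true)])) = weight (psi (fg [:: x])).
Proof.
by case: x => b [] //=; rewrite fg_neg_letter gmulfV val_fgV weight_invw.
Qed.

Lemma total_weight_transvection psi y z : y.1 \in S -> z.1 \in S -> y.1 != z.1 ->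
  total_weight (psi \o transvection y z) + weight (psi (fg [:: z])) =
  total_weight psi + weight (psi (fg [:: y] * fg [:: z])).
Proof.
move=> yS zS yz; rewrite /total_weight !(bigD1 z.1 zS) /=.
rewrite -/((psi \o transvection y z) _) !weight_pos_letter /= transvection_same.
rewrite (eq_bigr (fun b => weight (psi (fg [:: (b, true)])))).
  by rewrite addnC addnCA addnC.
by move=> b /andP[_ bz]; rewrite transvection_letter.
Qed.

Definition nielsen_minimal psi : Prop := forall y z,
  y.1 \in S -> z.1 \in S -> y.1 != z.1 ->
  weight (psi (fg [:: z])) <= weight (psi (fg [:: y] * fg [:: z])).

Lemma exists_nielsen_minimal psi :
  exists2 beta, aut_on S beta & nielsen_minimal (psi \o beta).
Proof.
have [beta betaS min] := exists_minimizer (P := aut_on S)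
  (fun beta : hom (free_group T) (free_group T) => total_weight (psi \o beta)) (aut_on_id S).
exists beta => // y z yS zS yz; have := total_weight_transvection (psi \o beta) yS zS yz.
have := min _ (aut_on_comp betaS (aut_on_transvection yS zS yz)).
rewrite /total_weight /=; lia.
Qed.

Lemma nielsen_minimal_right psi y z : nielsen_minimal psi ->
  y.1 \in S -> z.1 \in S -> y.1 != z.1 ->
  weight (psi (fg [:: y])) <= weight (psi (fg [:: y] * fg [:: z])).
Proof.
move=> min yS zS yz; have := min (inv_letter z) (inv_letter y) zS yS.
rewrite eq_sym => /(_ yz); rewrite !fg_inv_letter -invgM !gmulfV.
by rewrite !val_fgV !weight_invw.
Qed.

Lemma nielsen_minimal_not_prefix psi y z (p q : word U) : nielsen_minimal psi ->
  y.1 \in S -> z.1 \in S -> z != inv_letter y ->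
  word_fun psi [:: y] = p ++ invw q -> code p < code q -> ~~ prefix q (word_fun psi [:: z]).
Proof.
move=> min yS zS z_y ey lt_pq; have [yz|yz] := eqVneq y.1 z.1.
  by rewrite (eq_letter_index (esym yz) z_y) ey code_ltn_not_prefix // -ey reduced_fgval.
apply/negP => /prefixP[w ez].
have eyz : psi (fg [:: y] * fg [:: z]) = fg (p ++ w).
  by rewrite gmulfM -!(fg_word_fun psi) ey ez !fg_cat fg_invw -mulgA mulKg.
have le_pw : weight (psi (fg [:: y] * fg [:: z])) <= weight (p ++ w).
  by rewrite eyz; apply: weight_reduce.
have := leq_trans (min y z yS zS yz) le_pw.
have := leq_trans (nielsen_minimal_right min yS zS yz) le_pw.
rewrite -!/(word_fun psi _) ey ez; have [le_qw _|lt_wq + _] := leqP (size q) (size w).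
  by rewrite leqNgt weight_cat_ltn.
by rewrite leqNgt weight_lt_size // !size_cat size_invw ltn_add2l.
Qed.

End NielsenMinimal.

Section IsolatingExists.
Variables (T : finType) (S : {set T}).
Implicit Types (psi alpha : hom (free_group T) (free_group T)) (y z : letter T).

Lemma exists_balanced_letter_split psi :
  (forall y, y.1 \in S -> psi (fg [:: y]) != 1) ->
  exists (t : letter T -> word T) (c : letter T -> letter T),
    (forall y, c (inv_letter y) = inv_letter (c y)) /\
    forall y, y.1 \in S ->
      balanced_split (word_fun psi [:: y]) (t y) (c y) (t (inv_letter y)).
Proof.
move=> psi1.
have /fin_all_exists[d dP] (b : T) : exists d : word T * letter T * word T,
    b \in S -> balanced_split (word_fun psi [:: (b, true)]) d.1.1 d.1.2 d.2.
  have [bS|bS] := boolP (b \in S); last by exists ([::], (b, true), [::]).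
  have [|t [x [t' split_b]]] := balanced_split_exists (reduced_fgval (psi (fg [:: (b, true)]))).
    exact: psi1 (b, true) bS.
  by exists (t, x, t').
exists (fun y => if y.2 then (d y.1).1.1 else (d y.1).2).
exists (fun y => if y.2 then (d y.1).1.2 else inv_letter (d y.1).1.2).
split=> [[b []]|[b []]] //=; rewrite ?inv_letterK //; first exact: dP.
move/dP/balanced_split_invw; congr balanced_split.
by rewrite -val_fgV -gmulfV -fg_neg_letter.
Qed.

Lemma nielsen_minimal_isolating psi : nielsen_minimal S psi ->
  (forall y, y.1 \in S -> psi (fg [:: y]) != 1) -> exists t c, isolating S psi t c.
Proof.
move=> min /exists_balanced_letter_split[t [c [c_inv split_tc]]]; exists t, c; split=> //.
  by move=> y /split_tc[].
move=> y z yS zS zy; have [ey lt_ty _] := split_tc (inv_letter y) yS.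
apply: (nielsen_minimal_not_prefix min (y := inv_letter y) (p := t (inv_letter y))) => //.
- by rewrite inv_letterK.
- by rewrite ey c_inv inv_letterK invw_rcons.
- by move: lt_ty; rewrite c_inv !inv_letterK.
Qed.

Lemma exists_aut_core_size_leq alpha : {in fgOver S &, injective alpha} ->
  exists2 beta, aut_on S beta & forall H n, gens_over S H ->
    core_size [set: T] (map (word_fun alpha) H) n ->
    exists2 m, m <= n & core_size S (map (word_fun beta) H) m.
Proof.
move=> alpha_inj; have [gamma gammaS min] := exists_nielsen_minimal S alpha.
have [gamma' [gammaK _ gamma_over _]] := gammaS.
have [|t [c iso]] := nielsen_minimal_isolating min.
  move=> y yS; apply/eqP => /= alpha_y.
  suff /(can_inj gammaK)/(congr1 (@fgval T)) : gamma (fg [:: y]) = gamma 1 by [].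
  by apply: alpha_inj; rewrite ?gamma_over ?gpred1 ?fgOver_letter // !gmulf1.
have [beta betaS betaK] := aut_on_inv gammaS; exists beta => // H n HS.
have [beta' [_ _ beta_over _]] := betaS.
apply: (core_size_image_leq iso) => [_ /mapP[u uH ->]|h].
  by apply/beta_over/fgOver_fg/HS.
rewrite generated_map; split=> [[g gH ->]|[_ /generated_map[g gH ->] ->]].
  by exists (beta g); rewrite /= ?betaK //; apply/generated_map; exists g.
by exists g; rewrite //= betaK.
Qed.

End IsolatingExists.

Section AutomorphicImages.
Variables (T : finType) (S : {set T}) (Hs : seq (seq (word T))).
Hypothesis HsS : {in Hs, forall H, gens_over S H}.

Lemma seq_size_aut_extend f m : is_aut S f -> seq_size S (aut_img f Hs) m ->
  exists2 f', is_aut [set: T] f' & seq_size [set: T] (aut_img f' Hs) m.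
Proof.
move=> /is_aut_hom[phi phiS fE] size_f; have [phi' [_ _ phi_over _]] := phiS.
exists (word_fun phi); first exact/is_aut_word_fun/aut_on_setT/phiS.
rewrite (aut_img_word_fun (fun u _ => word_fun_reduce phi u) HsS) -(aut_img_word_fun fE HsS).
apply/(seq_size_sub _ (subsetT S)) => //; rewrite (aut_img_word_fun fE HsS).
by move=> _ /mapP[H HHs ->] _ /mapP[u uH ->]; apply/phi_over/fgOver_fg/(HsS HHs).
Qed.

Lemma seq_size_aut_restrict f m : is_aut [set: T] f -> seq_size [set: T] (aut_img f Hs) m ->
  exists f' m', [/\ is_aut S f', m' <= m & seq_size S (aut_img f' Hs) m'].
Proof.
move=> /is_aut_hom[alpha [alpha' [alphaK _ _ _]] fE].
have [beta betaS le_core] := exists_aut_core_size_leq (S := S) (in2W (can_inj alphaK)).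
have HsT : {in Hs, forall H, gens_over [set: T] H} by move=> H _ u _; apply: in_F_setT.
rewrite (aut_img_word_fun fE HsT) => size_alpha.
have [|m' le_m size_beta] := seq_size_map_leq (S := S) (G := map (word_fun beta)) _ size_alpha.
  by move=> H HHs n; apply/le_core/HsS.
exists (word_fun beta), m'; split=> //; first exact: is_aut_word_fun.
by rewrite (aut_img_word_fun (fun u _ => word_fun_reduce beta u) HsS).
Qed.

End AutomorphicImages.

Theorem lemma9p13 (T : finType) (B' : {set T}) (Hs : seq (seq (word T))) :
  (forall H, H \in Hs -> forall g, g \in H -> in_F B' g) ->
  (gersten B' Hs <-> gersten [set: T] Hs).
Proof.
move=> HsB'; have sizeE n : seq_size B' Hs n <-> seq_size [set: T] Hs n.
  exact: seq_size_sub (subsetT B') HsB'.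
split=> -[n [/sizeE Hsn min]]; exists n; split=> // f autf m fm.
  have [f' [m' [autf' le_m f'm']]] := seq_size_aut_restrict HsB' autf fm.
  exact: leq_trans (min f' autf' m' f'm') le_m.
have [f' autf' f'm] := seq_size_aut_extend HsB' autf fm.
exact: min f' autf' m f'm.
Qed.
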